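(* Let $G,H,(h_w)_{w>0},(L_{h_w(t)})_{t\in H},(\chi_w)_{w>0}$ satisfy all the standing assumptions listed in the context, and let $T_w$ be the associated operators $$T_wf(z)=\int_H\chi_w(z-h_w(t))\,L_{h_w(t)}f\,d\mu_H(t),\qquad z\in G.$$ Let $f\in C(G)$, i.e. $f:G\to\mathbb R$ is uniformly continuous and bounded. Then $T_wf$ converges uniformly to $f$, i.e. $$\lim_{w\to+\infty}\|T_wf-f\|_\infty=0.$$
   Context: Groups and spaces. $H$ and $G$ are locally compact Hausdorff topological groups with regular Haar measures $\mu_H$, $\mu_G$; $G$ is abelian, written additively, with neutral element $\theta_G$ ($H$ need not be abelian). $\mathcal B$ is a local base of neighbourhoods of $\theta_G$. For every $w>0$, $h_w:H\to G$ is a map which is a homeomorphism of $H$ onto $h_w(H)\subset G$. $M(G)$ is the space of measurable functions $f:G\to\mathbb R$; $L^\infty(G)$ consists of the bounded functions in $M(G)$ with $\|f\|_\infty=\sup_G|f|$ (functions are regarded as pointwise defined functions); $C(G)$ is the set of uniformly continuous bounded functions $G\to\mathbb R$. Notation. For $w>0$, $z\in G$ and measurable $A\subset G$: $A_{w,z}=\{t\in H: z-h_w(t)\in A\}$, $A_w=\{t\in H: h_w(t)\in A\}$, $\Upsilon_w(A)=\mu_H(A_w)$. Assumptions on the functionals. For every $w>0$, $(L_{h_w(t)})_{t\in H}$ is a family of linear operators $L_{h_w(t)}:M(G)\to\mathbb R$ such that: (L1) there is a constant $\Upsilon>0$ with $\sup_{\|f\|_\infty\le 1}|L_{h_w(t)}f|\le\Upsilon$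 for every $w>0$ and $t\in H$ (the supremum being over $f\in L^\infty(G)$); (L2) for every $f\in C(G)$ and every $\varepsilon>0$ there exist $\overline w(\varepsilon)>0$ and $B_\varepsilon\in\mathcal B$ such that if $z-h_w(t)\in B_\varepsilon$ and $w>\overline w$, then $|L_{h_w(t)}f-f(z)|<\varepsilon$. Assumptions on the kernels. $(\chi_w)_{w>0}\subset L^1(G)$ is a family of functions $\chi_w:G\to\mathbb R$ with $\|\chi_w\|_1<\Gamma$ for all $w>0$, for some constant $\Gamma>0$, such that: ($\chi_1$) $t\mapsto\chi_w(z-h_w(t))$ belongs to $L^1(H)$ for every $z\in G$, $w>0$; ($\chi_2$) $\int_H\chi_w(z-h_w(t))\,d\mu_H(t)=1$ for every $w>0$, $z\in G$; ($\chi_3$) $M:=\sup_{w>0}\sup_{z\in G}\int_H|\chi_w(z-h_w(t))|\,d\mu_H(t)<\infty$; ($\chi_4$) for every $B\in\mathcal B$, $\lim_{w\to+\infty}\int_{H\setminus B_{w,z}}|\chi_w(z-h_w(t))|\,d\mu_H(t)=0$ uniformly with respect to $z\in G$; ($\chi_5$) for every $\varepsilon>0$ and every compact $K\subset G$ there is a symmetric compact set $C\subset G$ such that, for all sufficiently large $w>0$ and every $t\in K_w$, $\int_{G\setminus C}\Upsilon_w(K)\,|\chi_w(z-h_w(t))|\,d\mu_G(z)<\varepsilon$. It is understood that the integrands appearing in the integrals (in particular $t\mapsto L_{h_w(t)}f$) are measurable. *)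

(* Defs.v *)
From HB Require Import structures.
From mathcomp Require Import all_boot all_order all_algebra.
From mathcomp Require Import all_classical all_reals all_analysis measurable_realfun.

Set Implicit Arguments.
Unset Strict Implicit.
Unset Printing Implicit Defensive.

Import Order.TTheory GRing.Theory Num.Theory.
Import numFieldNormedType.Exports.

Local Open Scope classical_set_scope.
Local Open Scope ring_scope.

HB.mixin Record isTopologicalGroup H of Group H & Topological H := {
  mulg_continuous : continuous (fun x : H * H => (x.1 * x.2)%g) ;
  invg_continuous : continuous (fun x : H => (x^-1)%g)
}.

#[short(type="topologicalGroupType")]
HB.structure Definition TopologicalGroup :=
  {H of isTopologicalGroup H & Group H & Topological H}.

(* A copy of [T] carrying its Borel sigma-algebra. Measurable types are pointed,
   hence the base point [t0]; it plays no other role. *)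
Definition borel (T : topologicalType) (t0 : T) : Type := T.

Section borel.
Context (T : topologicalType) (t0 : T).

HB.instance Definition _ := Choice.on (borel t0).
HB.instance Definition _ := isPointed.Build (borel t0) t0.
HB.instance Definition _ := @isMeasurable.Build (sigma_display (@open T))
  (borel t0) <<s @open T >> (@sigma_algebra0 _ setT (@open T))
  (@sigma_algebraC (borel t0) (@open T))
  (@sigma_algebra_bigcup _ setT (@open T)).

End borel.

Notation BorelZ G := (@borel G 0%R).
Notation BorelG H := (@borel H 1%g).

Section haar.
Context (R : realType).
Local Open Scope ereal_scope.

Definition regular_borel (T : topologicalType) (t0 : T)
    (mu : {measure set (borel t0) -> \bar R}) : Prop :=
  [/\ forall K : set T, compact K -> mu K < +oo,
      forall A : set (borel t0), measurable A ->
        mu A = ereal_inf [set mu U | U in [set U : set T | open U /\ A `<=` U]] &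
      forall U : set T, open U ->
        mu U = ereal_sup [set mu K | K in [set K : set T | compact K /\ K `<=` U]]].

(* Left Haar measure of a group written multiplicatively. *)
Definition haar (H : topologicalGroupType)
    (mu : {measure set (BorelG H) -> \bar R}) : Prop :=
  [/\ regular_borel mu, mu setT != 0 &
      forall (x : H) (A : set (BorelG H)), measurable A ->
        mu [set (x * y)%g | y in (A : set H)] = mu A].

(* Haar measure of an abelian group written additively. *)
Definition haarZ (G : topologicalZmodType)
    (mu : {measure set (BorelZ G) -> \bar R}) : Prop :=
  [/\ regular_borel mu, mu setT != 0 &
      forall (x : G) (A : set (BorelZ G)), measurable A ->
        mu [set (x + y)%R | y in (A : set G)] = mu A].

End haar.

Section function_spaces.
Context (R : realType) (G : topologicalZmodType).

Definition sup_norm (f : G -> R) : \bar R :=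
  ereal_sup [set `|f z|%:E | z in [set: G]].

(* [topologicalZmodType] carries no uniform structure; this is uniform
   continuity for the translation-invariant uniformity of [G]. *)
Definition unif_continuousZ (f : G -> R) : Prop :=
  forall eps : R, 0 < eps -> exists2 U : set G, nbhs 0 U &
    forall x y : G, U (x - y) -> `|f x - f y| < eps.

Definition CG : set (G -> R) :=
  [set f | unif_continuousZ f /\ bounded_fun f].

(* [C(G)] is contained in [M(G)]: taking [f] in [CG] to be a [{mfun _ >-> _}] is
   no restriction. *)
Lemma CG_measurable (f : G -> R) :
  CG f -> measurable_fun [set: BorelZ G] (f : BorelZ G -> R).
Proof.
move=> [fu _].
have fc : continuous (f : G -> R).
  move=> x; apply/cvgrPdist_lt => e e0.
  have [U U0 fU] := fu _ e0.
  have : \forall y \near x, U (x - y).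
    have c : (fun y : G => x - y) @ x --> (0 : G).
      rewrite -(subrr x).
      apply: (@continuous_comp _ _ _ (fun y => (x, y))
        (fun p : G * G => p.1 - p.2)); last exact: sub_continuous.
      by apply: cvg_pair => /=; [exact: cvg_cst|exact: cvg_id].
    exact: c.
  by apply: filterS => y /fU.
apply: (measurability _ (RGenOInfty.measurableE R)) => _ [_ [a ->] <-].
rewrite setTI; apply: sub_sigma_algebra.
by apply: open_comp => // x _; exact: fc.
Qed.

End function_spaces.

Definition local_base0 (G : topologicalZmodType) (B : set (set G)) : Prop :=
  (forall U, B U -> nbhs 0 U) /\
  (forall V, nbhs 0 V -> exists2 U, B U & U `<=` V).

Definition homeo_onto_range (T U : topologicalType) (h : T -> U) : Prop :=
  exists g : U -> T,
    [/\ cancel h g, continuous h & {within range h, continuous g}].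

Section operators.
Context (R : realType) (H : topologicalGroupType) (G : topologicalZmodType).
Context (muH : {measure set (BorelG H) -> \bar R}).
Context (muG : {measure set (BorelZ G) -> \bar R}).
Context (B : set (set G)).

(* All families are indexed by every real [w]; only [0 < w] is ever used. *)
Context (h : R -> H -> G).

(* [L w t] is the functional written $L_{h_w(t)}$: [h w] being injective, it may
   as well be indexed by [t]; it may depend on [w] beyond the point [h w t]. *)
Context (L : R -> H -> {linear {mfun BorelZ G >-> R} -> R^o}).
Context (chi : R -> G -> R).

Definition preim_shift (w : R) (z : G) (A : set G) : set H :=
  [set t | A (z - h w t)].

Definition Upsilon (w : R) (A : set G) : \bar R := muH (h w @^-1` A).

Record functional_family : Prop := FunctionalFamily {
  functional_bounded : exists2 Y : R, 0 < Y &
    forall (w : R) (t : H), 0 < w ->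
      (ereal_sup [set `|L w t f|%:E | f in
         [set f : {mfun BorelZ G >-> R} | sup_norm (f : G -> R) <= 1]]
       <= Y%:E)%E ;
  functional_approx : forall f : {mfun BorelZ G >-> R}, CG (f : G -> R) ->
    forall eps : R, 0 < eps ->
    exists wbar : R, 0 < wbar /\ exists2 U : set G, B U &
      forall (w : R) (z : G) (t : H), wbar < w -> U (z - h w t) ->
        `|L w t f - f z| < eps
}.

(* In [kernel_chi5], [Upsilon w K] may be infinite, so the product is taken in
   [\bar R] (with 0 * +oo = 0). *)
Record kernel_family : Prop := KernelFamily {
  kernel_integrable : forall w : R, 0 < w ->
    muG.-integrable [set: BorelZ G] (EFin \o chi w) ;
  kernel_L1_bounded : exists2 Gamma : R, 0 < Gamma &
    forall w : R, 0 < w -> ('N[muG]_1[EFin \o chi w] < Gamma%:E)%E ;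
  kernel_chi1 : forall (w : R) (z : G), 0 < w ->
    muH.-integrable [set: BorelG H] (fun t => (chi w (z - h w t))%:E) ;
  kernel_chi2 : forall (w : R) (z : G), 0 < w ->
    \int[muH]_t chi w (z - h w t) = 1 ;
  kernel_chi3 :
    (ereal_sup [set ereal_sup
        [set \int[muH]_t `|chi w (z - h w t)|%:E | z in [set: G]]
      | w in [set w : R | (0 < w)%R]] < +oo)%E ;
  kernel_chi4 : forall U : set G, B U -> forall eps : R, 0 < eps ->
    \forall w \near +oo, forall z : G,
      (\int[muH]_(t in ~` preim_shift w z U) `|chi w (z - h w t)|%:E
       < eps%:E)%E ;
  kernel_chi5 : forall (eps : R) (K : set G), 0 < eps -> compact K ->
    exists C : set G, [/\ compact C, [set - x | x in C] = C &
      \forall w \near +oo, forall t : H, (h w @^-1` K) t ->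
        (\int[muG]_(z in ~` C) (Upsilon w K * `|chi w (z - h w t)|%:E)
         < eps%:E)%E]
}.

Definition T_op (w : R) (f : {mfun BorelZ G >-> R}) (z : G) : R :=
  \int[muH]_t (chi w (z - h w t) * L w t f).

End operators.

(* Main.v *)
(* By [kernel_chi2], [T_w f z - f z] is the integral of
   [chi_w (z - h_w t) * (L_w,t f - f z)]. Where [z - h_w t] is close to 0 the
   second factor is small by [functional_approx]; elsewhere it is bounded by
   [functional_bounded], and the kernel has small mass there by [kernel_chi4]. *)
Require Import Defs.
From HB Require Import structures.
From mathcomp Require Import all_boot all_order all_algebra.
From mathcomp Require Import all_classical all_reals all_analysis measurable_realfun.

Set Implicit Arguments.
Unset Strict Implicit.
Unset Printing Implicit Defensive.

Import Order.TTheory GRing.Theory Num.Theory.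
Import numFieldNormedType.Exports.

Local Open Scope classical_set_scope.
Local Open Scope ring_scope.

(* No measurability is assumed: members of a local base, hence the domains in
   [kernel_chi4], need not be Borel. *)
Lemma ge0_le_integral_subset (d : measure_display) (T : measurableType d)
    (R : realType) (mu : {measure set T -> \bar R}) (D E : set T)
    (f : T -> \bar R) :
  D `<=` E -> (forall x, 0 <= f x)%E ->
  (\int[mu]_(x in D) f x <= \int[mu]_(x in E) f x)%E.
Proof.
move=> DE f0; rewrite !ge0_integralE//.
apply: ereal_sup_le => _ [g /= gf <-]; exists g => //= x.
apply: le_trans (gf x) _; rewrite !patchE.
case: ifPn => [/set_mem/DE/mem_set ->//|_].
by case: ifPn.
Qed.

(** Since [k] has total integral 1, subtracting [c] turns the integrand into [k t * (phi t - c)].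
    Splitting at [O] bounds it by [e] times the mass of [k] on [O], at most [M], plus [D] times its
    mass off [O], at most [r]. *)
Lemma Rintegral_weighted_dist (d : measure_display) (T : measurableType d)
    (R : realType) (mu : {measure set T -> \bar R}) (O : set T)
    (k phi : T -> R) (c e D M r : R) :
  measurable O -> mu.-integrable setT (EFin \o k) ->
  measurable_fun setT phi -> \int[mu]_t k t = 1 ->
  0 <= e -> 0 <= D ->
  (forall t, O t -> `|phi t - c| <= e) -> (forall t, `|phi t - c| <= D) ->
  (\int[mu]_t `|k t|%:E <= M%:E)%E ->
  (\int[mu]_(t in ~` O) `|k t|%:E <= r%:E)%E ->
  `|\int[mu]_t (k t * phi t) - c| <= e * M + D * r.
Proof.
move=> mO ik mphi k1 e0 D0 phiO phiD kM kr.
have mk : measurable_fun setT k.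
  by apply/measurable_EFinP; exact: (measurable_int mu).
have mO' := measurableC mO.
have mnk A : measurable_fun A (fun t => `|k t|%:E).
  apply: measurable_funTS; apply/measurable_EFinP.
  exact: measurableT_comp.
have mg : measurable_fun setT (fun t => k t * (phi t - c)).
  by apply: measurable_funM => //; apply: measurable_funB.
(* Used twice below: with [O] and [e], then with the complement of [O] and [D]. *)
have gO A a : measurable A -> 0 <= a ->
    (forall t, A t -> `|phi t - c| <= a) ->
    (\int[mu]_(t in A) `|k t * (phi t - c)|%:E
      <= a%:E * \int[mu]_(t in A) `|k t|%:E)%E.
  move=> mA a0 phia; rewrite -ge0_integralZl_EFin//.
  apply: ge0_le_integral => //.
  - apply: measurable_funTS; apply/measurable_EFinP.
    exact: measurableT_comp.
  - exact: measurable_funeM.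
  - move=> t At; rewrite -EFinM lee_fin normrM mulrC.
    by rewrite ler_wpM2r// phia.
(* Dominated by [D * k], thanks to the global bound on [phi - c]. *)
have ig : mu.-integrable setT (EFin \o (fun t => k t * (phi t - c))).
  apply: (le_integrable _ _ _ (integrableZl measurableT D ik)) => //.
    exact/measurable_EFinP.
  move=> t _ /=; rewrite lee_fin !normrM mulrC (ger0_norm D0).
  by rewrite ler_wpM2r.
have ikc : mu.-integrable setT (EFin \o (fun t => k t * c)).
  apply: eq_integrable (integrableZr measurableT c ik) => // t _ /=.
have -> : \int[mu]_t (k t * phi t) - c = \int[mu]_t (k t * (phi t - c)).
  rewrite -[X in _ - X]mul1r -k1 -RintegralZr// -RintegralB//.
    by apply: eq_Rintegral => t _; rewrite mulrBr.
  apply: eq_integrable (integrableD measurableT ig ikc) => // t _ /=.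
  by rewrite -EFinD -mulrDr subrK.
have gbd : (\int[mu]_t `|k t * (phi t - c)|%:E <= (e * M + D * r)%:E)%E.
  rewrite -[X in integral _ X _](setUv O) ge0_integral_setU//; last 2 first.
  - apply: measurable_funTS; apply/measurable_EFinP; exact: measurableT_comp.
  - by apply/disj_setPS; rewrite setICr.
  rewrite EFinD !EFinM leeD//.
  - apply: le_trans (gO _ _ mO e0 phiO) _; rewrite lee_wpmul2l ?lee_fin//.
    apply: le_trans kM; exact: ge0_le_integral_subset.
  - apply: le_trans (gO _ _ mO' D0 (fun t _ => phiD t)) _.
    by rewrite lee_wpmul2l ?lee_fin.
apply: le_trans (le_normr_Rintegral measurableT ig) _.
rewrite -lee_fin; apply: le_trans gbd.
rewrite /Rintegral fineK//.
exact: integrable_fin_num (integrable_norm ig).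
Qed.

Lemma open_measurable_borel (T : topologicalType) (t0 : T) (U : set T) :
  open U -> measurable (U : set (borel t0)).
Proof. exact: sub_sigma_algebra. Qed.

(** Makes the set at which the integral over [H] is split a Borel set. *)
Lemma open_preim_shift (R : realType) (H : topologicalGroupType)
    (G : topologicalZmodType) (h : R -> H -> G) (w : R) (z : G) (U : set G) :
  continuous (h w) -> open U -> open (preim_shift h w z U).
Proof.
move=> hc oU.
apply: (@open_comp _ _ (fun t => z - h w t) U) => // t _.
apply: (@continuous_comp _ _ _ (fun t => (z, h w t))
  (fun p : G * G => p.1 - p.2)); last exact: sub_continuous.
by apply: cvg_pair => /=; [exact: cvg_cst|exact: hc].
Qed.

(** By homogeneity: [N^-1 *: f] lies in the unit ball, where [functional_bounded] applies. *)
Lemma functional_norm_le (R : realType) (H : topologicalGroupType)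
    (G : topologicalZmodType) (B : set (set G)) (h : R -> H -> G)
    (L : R -> H -> {linear {mfun BorelZ G >-> R} -> R^o})
    (f : {mfun BorelZ G >-> R}) (N : R) :
  functional_family B h L -> 0 < N -> (forall z, `|f z| <= N) ->
  exists2 Y : R, 0 < Y & forall (w : R) t, 0 < w -> `|L w t f : R| <= N * Y.
Proof.
move=> Lfam N0 fN; have [Y Y0 LY] := functional_bounded Lfam.
exists Y => // w t w0.
have LE : L w t (N^-1 *: f) = N^-1 * (L w t f : R) :> R by exact: linearZ.
rewrite -ler_pdivrMl// -{1}(gtr0_norm N0) -normfV -normrM -LE -lee_fin.
apply: le_trans (LY w t w0); apply: ereal_sup_ubound.
exists (N^-1 *: f) => //=; apply: ge_ereal_sup => _ [z _ <-].
rewrite lee_fin -[_ z]/(N^-1 * f z) normrM normfV (gtr0_norm N0).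
by rewrite ler_pdivrMl// mulr1.
Qed.

Lemma sup_norm_cvg0 (R : realType) (G : topologicalZmodType)
    (u : R -> G -> R) :
  (forall e : R, 0 < e -> \forall w \near +oo, forall z, `|u w z| <= e) ->
  sup_norm (u w) @[w --> +oo] --> 0%E.
Proof.
move=> u0.
(* The point 0 of [G] shows that the supremum is over a nonempty set, so it is not [-oo]. *)
have ge0 w : (0 <= sup_norm (u w))%E.
  apply: (@le_trans _ _ `|u w 0|%:E); first by rewrite lee_fin.
  by apply: ereal_sup_ubound; exists 0.
have lee (e : R) : 0 < e -> \forall w \near +oo, (sup_norm (u w) <= e%:E)%E.
  move=> /u0; apply: filterS => w uwe.
  by apply: ge_ereal_sup => _ [z _ <-]; rewrite lee_fin.
have fin w e : (sup_norm (u w) <= e%:E)%E -> sup_norm (u w) \is a fin_num.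
  by move=> le; rewrite ge0_fin_numE// (le_lt_trans le)// ltry.
(* Convergence in [\bar R] reduces to eventual finiteness, obtained with tolerance 1, and
   convergence of the real values. *)
apply/fine_cvgP; split; first by apply: filterS (lee 1 ltr01) => w; exact: fin.
apply/cvgrPdist_le => e e0; apply: filterS (lee e e0) => w le.
rewrite sub0r normrN /= ger0_norm ?fine_ge0//.
by rewrite -lee_fin fineK// (fin _ _ le).
Qed.

Theorem theorem4p2 (R : realType)
    (H : topologicalGroupType) (G : topologicalZmodType)
    (muH : {measure set (BorelG H) -> \bar R})
    (muG : {measure set (BorelZ G) -> \bar R})
    (B : set (set G))
    (h : R -> H -> G)
    (L : R -> H -> {linear {mfun BorelZ G >-> R} -> R^o})
    (chi : R -> G -> R)
    (H_hausdorff : hausdorff_space H) (H_lc : locally_compact [set: H])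
    (G_hausdorff : hausdorff_space G) (G_lc : locally_compact [set: G])
    (muH_haar : haar muH) (muG_haar : haarZ muG)
    (B_base : local_base0 B)
    (h_homeo : forall w : R, 0 < w -> homeo_onto_range (h w))
    (L_family : functional_family B h L)
    (chi_family : kernel_family muH muG B h chi)
    (f : {mfun BorelZ G >-> R})
    (f_CG : CG (f : G -> R))
    (Lf_meas : forall w : R, 0 < w ->
       measurable_fun [set: BorelG H] (fun t => (L w t f : R))) :
  sup_norm (fun z : G => T_op muH h L chi w f z - f z) @[w --> +oo] --> 0%E.
Proof.
have [_ [M0 [_ fM]]] := f_CG.
(* [bounded_fun] gives a bound by every real strictly above [M0]; this choice is also positive, as
   the rescaling of [f] by [N^-1] requires. *)
pose N : R := `|M0| + 1.
have N0 : 0 < N by rewrite ltr_wpDl.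
have fN z : `|f z| <= N.
  by apply: fM => //; rewrite /N (le_lt_trans (ler_norm _))// ltrDl.
have [Y Y0 LY] := functional_norm_le L_family N0 fN.
have [M Mge0 chiM] : exists2 M : R, 0 <= M & forall (w : R) z, 0 < w ->
    (\int[muH]_t `|chi w (z - h w t)|%:E <= M%:E)%E.
  have := kernel_chi3 chi_family.
  set S := ereal_sup _ => Soo.
  have leS w z : 0 < w -> (\int[muH]_t `|chi w (z - h w t)|%:E <= S)%E.
    move=> w0; apply: (@le_trans _ _ (ereal_sup
      [set \int[muH]_t `|chi w (z - h w t)|%:E | z in [set: G]])%E).
      by apply: ereal_sup_ubound; exists z.
    by apply: ereal_sup_ubound; exists w.
  have S0 : (0 <= S)%E.
    by apply: le_trans (leS 1 0 ltr01); exact: integral_ge0.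
  exists (fine S); first exact: fine_ge0.
  by move=> w z w0; rewrite fineK ?ge0_fin_numE//; exact: leS.
apply: sup_norm_cvg0 => e e0.
(* Bounds [L w t f - f z] in absolute value for all [t] and [z], by the triangle inequality. *)
pose D := N * Y + N.
have D0 : 0 <= D by rewrite addr_ge0 ?mulr_ge0 ?ltW.
have MD0 : 0 < M + D + 1 by rewrite ltr_wpDl// addr_ge0.
(* The common tolerance for [functional_approx] and [kernel_chi4]: the final bound [a * M + D * a]
   is then at most [e], and the added 1 keeps the denominator positive. *)
pose a : R := e / (M + D + 1).
have a0 : 0 < a by rewrite divr_gt0.
have [wbar [wbar0 [U BU Lf]]] := functional_approx L_family f_CG a0.
(* [U] need not be open; shrinking its interior to a member [V] of the base
   lets [kernel_chi4] control the complement of that interior. *)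
have [V BV VU] := B_base.2 _ (open_nbhs_nbhs (conj (@open_interior _ U)
  (nbhs_singleton (nbhs_interior (B_base.1 _ BU))))).
have := kernel_chi4 chi_family BV a0.
have := nbhs_pinfty_gt (num_real wbar).
(* The point [z] enters only after [w] is fixed, so the estimate is uniform in [z]. *)
apply: filterS2 => w wbarw chi4 z.
have w0 : 0 < w by exact: lt_trans wbarw.
have [_ [_ hc _]] := h_homeo w w0.
apply: (@le_trans _ _ (a * M + D * a)); last first.
  rewrite [D * a]mulrC -mulrDr /a mulrAC ler_pdivrMr// ler_pM2l//.
  by rewrite lerDl.
apply: (@Rintegral_weighted_dist _ (BorelG H) R muH (preim_shift h w z U°)
  (fun t => chi w (z - h w t)) (fun t => L w t f)) => //.
- apply: open_measurable_borel; apply: open_preim_shift => //.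
  exact: open_interior.
- exact: (kernel_chi1 chi_family).
- exact: Lf_meas.
- exact: (kernel_chi2 chi_family).
- exact: ltW.
- by move=> t /interior_subset Ut; apply/ltW/Lf.
- move=> t; apply: le_trans (ler_normB _ _) _.
  by rewrite lerD// LY.
- exact: chiM.
(* As [V] lies in the interior of [U], leaving that interior means leaving [V]. *)
- apply: le_trans (ltW (chi4 z)).
  by apply: ge0_le_integral_subset => // t nO /VU.
Qed.
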